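(* Let $n\ge1$, $B_n=\{0,1\}^n$, and for $\sigma\in S_n$ let $\sigma'$ be the permutation of $B_n$ given by $\sigma'(x_1,\dots,x_n)=(x_{\sigma(1)},\dots,x_{\sigma(n)})$. Let $\sigma=\alpha_1\alpha_2\cdots\alpha_m$ be the decomposition of $\sigma$ into disjoint cycles, with $\alpha_i$ of length $k_i$ (so $k_1+\dots+k_m=n$, fixed points counted as cycles of length $1$). Define integers $e(k)$, $k\ge1$, by $e(1)=2$ and $$e(k)=\frac1k\Big(2^k-\sum_{d\mid k,\ d<k} d\,e(d)\Big),\quad k>1.$$ Then the cycle index monomial $\prod_j f_j^{p'_j}$ of $\sigma'$ is $$\prod_{z_1\mid k_1}\prod_{z_2\mid k_2}\cdots\prod_{z_m\mid k_m} f_{\langle z_1,\dots,z_m\rangle}^{\prod_{i=1}^m z_i e(z_i)/\langle z_1,\dots,z_m\rangle};$$ that is, for every $j\ge1$ the number $p'_j$ of cycles of length $j$ of $\sigma'$ equals $$p'_j=\sum_{\substack{(z_1,\dots,z_m):\ z_i\mid k_i\ \forall i\\ \langle z_1,\dots,z_m\rangle=j}}\frac{\prod_{i=1}^m z_i\,e(z_i)}{j}.$$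
   Context: $\langle z_1,\dots,z_m\rangle$ denotes the least common multiple of $z_1,\dots,z_m$. The cycle index monomial of a permutation with $p'_j$ cycles of length $j$ is $\prod_j f_j^{p'_j}$ in independent variables $f_j$; monomials $f_a^{u}$ and $f_a^{v}$ multiply as usual ($f_a^{u+v}$). *)

(* Defs.v *)
(* Library: Mathematical Components, with multinomials for free commutative
   monomials. *)
From mathcomp Require Export all_boot all_order all_fingroup all_algebra.
From mathcomp Require Export monalg.
Set Implicit Arguments.
Unset Strict Implicit.
Unset Printing Implicit Defensive.
Import Order.TTheory GRing.Theory Num.Theory.

Local Open Scope ring_scope.

Definition cube (n : nat) := {ffun 'I_n -> bool}.

Definition cube_act (n : nat) (sigma : 'S_n) (x : cube n) : cube n :=
  [ffun i => x (sigma i)].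

Lemma cube_act_inj (n : nat) (sigma : 'S_n) : injective (cube_act sigma).
Proof.
move=> x y /ffunP exy; apply/ffunP=> i.
by move: (exy ((sigma^-1)%g i)); rewrite !ffunE permKV.
Qed.

Definition cube_perm (n : nat) (sigma : 'S_n) : {perm cube n} :=
  perm (@cube_act_inj n sigma).

(* The orbits in [porbits s] include the fixed points of [s], as singletons. *)
Definition ncycles (T : finType) (s : {perm T}) (j : nat) : nat :=
  #|[set C in porbits s | #|C| == j]|.

(* Monomials in the independent variables f_0, f_1, ... are the elements of the
   free commutative monoid {cmonom nat}; [fpow a u] is f_a ^ u. *)
Definition fpow (a u : nat) : {cmonom nat} := expcmn (ucm a) u.

Notation "\mprod_ ( i | P ) F" := (\big[mmul/mone]_(i | P) F)
  (at level 36, F at level 36, i at level 50,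
   format "'[' \mprod_ ( i  |  P ) '/  '  F ']'").

(* A cycle has length at most #|T|, so the product over all j >= 1 is finite. *)
Definition cycle_index_monomial (T : finType) (s : {perm T}) : {cmonom nat} :=
  \big[mmul/mone]_(1 <= j < #|T|.+1) fpow j (ncycles s j).

(* The first argument is a recursion bound; any bound >= k gives e(k).  The
   values are rationals because the recurrence divides by k. *)
Fixpoint e_rec (bound k : nat) : rat :=
  if bound is b.+1 then
    if k == 1%N then 2
    else k%:R^-1 * (2 ^+ k - \sum_(1 <= d < k | (d %| k)%N) d%:R * e_rec b d)
  else 0.

Definition e (k : nat) : rat := e_rec k k.

Lemma e_rec_bound (b k : nat) : (k <= b)%N -> (0 < k)%N -> e_rec b k = e k.
Proof.
have [N] := ubnP k; elim: N k b => // N IH k b kN.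
rewrite /e; case: b => [|b]; first by rewrite leqn0 => /eqP->.
case: k kN => // k kN kb _ /=; case: eqP => // _.
congr (_ * (_ - _)); rewrite big_nat_cond [RHS]big_nat_cond.
apply: eq_bigr => d /andP[/andP[d1 dk] _].
have dN : (d < N)%N by rewrite ltnS in kN; exact: ssrnat.leq_trans dk kN.
rewrite (IH d b) ?(IH d k) //.
by rewrite -ltnS; exact: ssrnat.leq_trans dk kb.
Qed.

Lemma e1 : e 1 = 2.
Proof. by []. Qed.

Lemma eE (k : nat) : (1 < k)%N ->
  e k = k%:R^-1 * (2 ^+ k - \sum_(1 <= d < k | (d %| k)%N) d%:R * e d).
Proof.
case: k => // k k1; rewrite {1}/e /= ifN ?neq_ltn ?k1 ?orbT //.
congr (_ * (_ - _)); rewrite big_nat_cond [RHS]big_nat_cond.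
by apply: eq_bigr => d /andP[/andP[d1 dk] _]; rewrite e_rec_bound.
Qed.

Definition lcm_tuple (m N : nat) (z : {ffun 'I_m -> 'I_N}) : nat :=
  \big[lcmn/1%N]_(i < m) z i.

Definition expo (m N : nat) (z : {ffun 'I_m -> 'I_N}) : rat :=
  (\prod_(i < m) ((z i)%:R * e (z i))) / (lcm_tuple z)%:R.

(* Main.v *)
(** Write sigma' for the permutation induced on the cube.  A word supported on
    a cycle of length k and fixed by sigma'^z, z | k, is z-periodic along the
    cycle, so there are 2^z of them; sorting them by the length of their
    sigma'-orbit, the recurrence for e says that exactly z e(z) of them have
    orbit length z.  A point x of the cube is the family of its restrictions to
    the cycles of sigma, and restriction commutes with sigma': hence the orbit
    length of x is the lcm of the orbit lengths z_i of its restrictions, and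
    prod_i z_i e(z_i) points have prescribed lengths (z_i).  These points form a
    sigma'-stable set all of whose orbits have length lcm(z_i), so dividing by
    this lcm counts the orbits. *)
Require Import Defs.
Set Implicit Arguments.
Unset Strict Implicit.
Unset Printing Implicit Defensive.
Import Order.TTheory GRing.Theory Num.Theory.
Local Open Scope ring_scope.

(** * Orbit lengths and orbit counts of a permutation *)

(** Reduce [N] modulo the orbit size: the points of one turn round the orbit are distinct, so only
    remainder 0 fixes [x]. *)
Lemma permX_fix (T : finType) (s : {perm T}) (x : T) (N : nat) :
  ((s ^+ N)%g x == x) = (#|porbit s x| %| N)%N.
Proof.
set p := #|porbit s x|.
have p0 : (0 < p)%N by rewrite lt0n card_porbit_neq0.
have sMp q : iter (q * p) s x = x.
  elim: q => // q IH; rewrite mulSn iterD IH; exact: iter_porbit.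
rewrite permX {1}(divn_eq N p) addnC iterD sMp /dvdn.
have lt_r : (N %% p < p)%N by rewrite ltn_mod.
have := nth_uniq x _ _ (uniq_traject_porbit s x).
move=> /(_ (N %% p)%N 0%N); rewrite size_traject -/p => /(_ lt_r p0).
by rewrite !nth_traject.
Qed.

(** Stability makes the orbits of the points of [A] a partition of [A] into blocks of size [l]. This
    turns counts of points into counts of cycles. *)
Lemma card_orbits_uniform (T : finType) (s : {perm T}) (A : {set T}) (l : nat) :
    {in A, forall x, s x \in A} -> {in A, forall x, #|porbit s x| = l} ->
  #|A| = (#|porbit s @: A| * l)%N.
Proof.
move=> sA lA; apply: card_uniform_partition.
  by move=> _ /imsetP[x Ax ->]; apply: lA.
have sub x : x \in A -> porbit s x \subset A.
  move=> Ax; apply/subsetP=> _ /porbitP[i ->].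
  by elim: i => [|i IH]; rewrite ?perm1 // expgSr permM sA.
apply/and3P; split.
- rewrite eqEsubset; apply/andP; split.
    by apply/bigcupsP=> _ /imsetP[x Ax ->]; apply: sub.
  apply/subsetP=> x Ax; apply/bigcupP.
  by exists (porbit s x); rewrite ?imset_f ?porbit_id.
- apply/trivIsetP=> _ _ /imsetP[x _ ->] /imsetP[y _ ->] neq.
  rewrite -setI_eq0; apply: contraR neq => /set0Pn[z /setIP[zx zy]].
  by move: zx zy; rewrite -!eq_porbit_mem => /eqP<- /eqP<-.
- by apply/imsetP=> -[x _ e]; have := porbit_id s x; rewrite -e inE.
Qed.

Lemma card_ncycles (T : finType) (s : {perm T}) (j : nat) :
  #|[set x | #|porbit s x| == j]| = (ncycles s j * j)%N.
Proof.
rewrite (@card_orbits_uniform _ s _ j).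
- congr (#|pred_of_set _| * _)%N; apply/setP=> C; rewrite inE.
  apply/imsetP/andP=> [[x]|[/imsetP[x _ ->]]]; last by exists x; rewrite ?inE.
  by rewrite inE => + ->; rewrite imset_f.
- by move=> x; rewrite !inE (porbit_perm s 1).
- by move=> x; rewrite inE => /eqP.
Qed.

(** * Words supported on a single cycle *)

Lemma cube_permX (n : nat) (s : 'S_n) (N : nat) (x : cube n) (i : 'I_n) :
  (cube_perm s ^+ N)%g x i = x ((s ^+ N)%g i).
Proof.
elim: N x i => [|N IH] x i; first by rewrite !expg0 !perm1.
by rewrite expgSr expgS !permM permE ffunE IH.
Qed.

Lemma porbitsX_mem (T : finType) (s : {perm T}) (C : {set T}) (N : nat) (i : T) :
  C \in porbits s -> ((s ^+ N)%g i \in C) = (i \in C).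
Proof.
by case/imsetP=> a _ ->; rewrite -!eq_porbit_mem; rewrite porbit_perm.
Qed.

(** Words on [C] are extended by [false] to the whole cube, so that [cube_perm] acts on them
    directly. *)
Definition words (n : nat) (C : {set 'I_n}) : {set cube n} :=
  [set w : cube n | [forall i, w i ==> (i \in C)]].

Lemma words_out (n : nat) (C : {set 'I_n}) (w : cube n) (i : 'I_n) :
  w \in words C -> i \notin C -> w i = false.
Proof. by rewrite inE => /forallP/(_ i)/implyP h; apply: contraNF. Qed.

(* The orbit length of w divides z exactly when w is fixed by the z-th power. *)
Lemma card_fixed_words (n : nat) (s : 'S_n) (C : {set 'I_n}) (z : nat) :
    C \in porbits s -> (z %| #|C|)%N ->
  #|[set w in words C | (#|porbit (cube_perm s) w| %| z)%N]| = (2 ^ z)%N.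
Proof.
move=> Cs; case/imsetP: (Cs) => a _ defC.
set k := #|C| => zk.
have k0 : (0 < k)%N by rewrite /k defC lt0n card_porbit_neq0.
case: z zk => [|z zk]; first by rewrite dvd0n => /eqP e; rewrite e in k0.
(* [ix i] is the position of [i] on the cycle, counted from [a]. As [z.+1] divides [k], going once
   round the cycle does not change it modulo [z.+1]. *)
pose ix i := index i (traject s a k).
have CP i : i \in C -> exists t, i = (s ^+ t)%g a by rewrite defC => /porbitP.
have Ca t : (s ^+ t)%g a \in C by rewrite defC mem_porbit.
have ixE t : (ix ((s ^+ t)%g a) = t %[mod z.+1])%N.
  suff -> : ix ((s ^+ t)%g a) = (t %% k)%N by rewrite modn_dvdm.
  have -> : (s ^+ t)%g a = nth a (traject s a k) (t %% k).
    rewrite nth_traject ?ltn_mod // -permX {1}(divn_eq t k) expgD permM.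
    congr (_ _); apply/eqP; rewrite permX_fix -defC; exact: dvdn_mull.
  by rewrite /ix index_uniq ?size_traject ?ltn_mod // /k defC uniq_traject_porbit.
(* [g] repeats a block of [z.+1] letters along [C]; its image is the set of fixed words. *)
pose g (v : {ffun 'I_z.+1 -> bool}) : cube n :=
  [ffun i => (i \in C) && v (inord (ix i %% z.+1))].
have gE v t : g v ((s ^+ t)%g a) = v (inord (t %% z.+1)).
  by rewrite ffunE Ca ixE.
have g_inj : injective g.
  move=> u v /ffunP e; apply/ffunP=> t.
  by have := e ((s ^+ t)%g a); rewrite !gE modn_small ?ltn_ord // inord_val.
transitivity #|g @: {ffun 'I_z.+1 -> bool}|; last first.
  by rewrite card_imset // card_ffun card_bool card_ord.
apply: eq_card => w; rewrite !inE -permX_fix; apply/andP/imsetP.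
- case=> wC /eqP/ffunP fw; exists [ffun t : 'I_z.+1 => w ((s ^+ t)%g a)] => //.
  apply/ffunP=> i; have [iC|iC] := boolP (i \in C); last first.
    by rewrite ffunE (negPf iC) (words_out _ iC) // inE.
  have [t ->] := CP _ iC; rewrite gE ffunE inordK ?ltn_mod //.
  (* Since [w] is fixed by the power [z.+1], multiples of [z.+1] are stripped from the exponent one
     at a time. *)
  rewrite {1}(divn_eq t z.+1) addnC expgD permM.
  elim: (t %/ z.+1)%N => [|q IH]; first by rewrite mul0n perm1.
  by rewrite mulSnr expgD permM -cube_permX fw.
- case=> v _ ->; split.
    by apply/forallP=> i; apply/implyP; rewrite ffunE => /andP[].
  apply/eqP/ffunP=> i; rewrite cube_permX.
  have [iC|iC] := boolP (i \in C); last first.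
    by rewrite !ffunE porbitsX_mem // (negPf iC).
  by have [t ->] := CP _ iC; rewrite -permM -expgD !gE modnDr.
Qed.

(** The recurrence chooses [e d] so that [d * e d] completes the sum over proper divisors to
    [2 ^ d]. *)
Lemma sum_divisors_e (d : nat) : (0 < d)%N ->
  \sum_(1 <= c < d.+1 | (c %| d)%N) c%:R * e c = 2 ^+ d.
Proof.
case: d => // -[|d] _; first by rewrite big_ltn_cond // big_geq // e1 mul1r addr0.
rewrite big_mkcond big_nat_recr //= -big_mkcond dvdnn (@eE d.+2) //=.
by rewrite mulrA divff ?mul1r ?pnatr_eq0 // addrC subrK.
Qed.

(** Inversion over divisors by strong induction: the counts and the numbers [c * e c] have the same
    divisor sum at [d] and agree at proper divisors, so their top terms agree. *)
Lemma card_words_period (n : nat) (s : 'S_n) (C : {set 'I_n}) (d : nat) :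
    C \in porbits s -> (d %| #|C|)%N ->
  #|[set w in words C | #|porbit (cube_perm s) w| == d]|%:R = d%:R * e d :> rat.
Proof.
move=> Cs; have C0 : (0 < #|C|)%N.
  by case/imsetP: Cs => a _ ->; rewrite lt0n card_porbit_neq0.
have [N] := ubnP d; elim: N d => // N IH d dN dk.
have d0 : (0 < d)%N := dvdn_gt0 C0 dk.
pose cnt c := #|[set w in words C | #|porbit (cube_perm s) w| == c]|.
have: \sum_(1 <= c < d.+1 | (c %| d)%N) (cnt c)%:R
    = \sum_(1 <= c < d.+1 | (c %| d)%N) c%:R * e c.
  rewrite sum_divisors_e // -natrX -(card_fixed_words Cs dk) -natr_sum.
  congr (_%:R); rewrite -sum1_card.
  (* Index 0 can be added because it does not divide [d]; ordinals then index the orbit lengths. *)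
  transitivity (\sum_(0 <= c < d.+1 | c %| d) cnt c)%N.
    by rewrite [RHS]big_ltn_cond // dvd0n -[_ == _]negbK -lt0n d0.
  rewrite big_mkord.
  rewrite [RHS](@partition_big _ _ _ _ _ _ _
    (fun w => inord #|porbit (cube_perm s) w|) (fun c : 'I_d.+1 => c %| d)%N).
    apply: eq_bigr => c cd; rewrite /cnt -sum1_card; apply: eq_bigl => w.
    rewrite !inE -andbA; case: [forall i, _] => //=; apply/idP/andP.
      by move=> /eqP->; rewrite inord_val.
    case=> wd /eqP<-; rewrite inordK // ltnS; exact: dvdn_leq.
  by move=> w; rewrite inE => /andP[_ wd]; rewrite inordK // ltnS dvdn_leq.
rewrite big_mkcond [X in _ = X]big_mkcond !big_nat_recr //= !dvdnn.
under eq_big_nat => c /andP[c1 cd].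
  rewrite (_ : (if _ then _ else _) = if (c %| d)%N then c%:R * e c else 0).
    over.
  case: ifP => // cdvd; apply: IH; last exact: dvdn_trans dk.
  by apply: ssrnat.leq_trans cd _.
by move/addrI.
Qed.

(* The words of orbit length l for an l-cycle number l e(l) and split into
   orbits of size l. *)
Lemma e_nat (l : nat) : (1 <= l)%N -> e l \is a Num.nat.
Proof.
case: l => // l _; pose s : 'S_l.+1 := perm (@ordS_inj l.+1).
have sX (t : nat) : (t < l.+1)%N -> (s ^+ t)%g ord0 = t :> nat.
  elim: t => [|t IH] tl; first by rewrite perm1.
  by rewrite expgSr permM permE /= IH ?modn_small // ltnW.
have sT : porbit s ord0 = setT.
  apply/setP=> i; rewrite inE; apply/porbitP; exists i; apply: val_inj.
  by rewrite /= sX.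
have Cs : [set: 'I_l.+1] \in porbits s by rewrite -sT imset_f.
have := card_words_period (d := l.+1) Cs; rewrite cardsT card_ord dvdnn.
move=> /(_ isT).
rewrite (@card_orbits_uniform _ (cube_perm s) _ l.+1).
- move=> h; have -> : e l.+1 = (l.+1%:R)^-1 * (l.+1%:R * e l.+1).
    by rewrite mulrA mulVf ?mul1r ?pnatr_eq0.
  by rewrite -h natrM mulrCA mulVf ?pnatr_eq0 // mulr1 natr_nat.
- move=> w; rewrite !inE (porbit_perm _ 1) => /andP[_ ->]; rewrite andbT.
  by apply/forallP=> i; rewrite inE implybT.
- by move=> w; rewrite inE => /andP[_ /eqP].
Qed.

(** * Restrictions of a point to the cycles *)

Definition restr (n : nat) (C : {set 'I_n}) (x : cube n) : cube n :=
  [ffun i => (i \in C) && x i].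

Lemma restr_permX (n : nat) (s : 'S_n) (C : {set 'I_n}) (N : nat) (x : cube n) :
    C \in porbits s ->
  (cube_perm s ^+ N)%g (restr C x) = restr C ((cube_perm s ^+ N)%g x).
Proof.
move=> Cs; apply/ffunP=> i.
by rewrite cube_permX !ffunE cube_permX porbitsX_mem.
Qed.

Lemma mem_cycle_tuple (n m : nat) (s : 'S_n) (alpha : m.-tuple {set 'I_n}) :
    perm_eq alpha (enum (porbits s)) ->
  forall i, tnth alpha i \in porbits s.
Proof. by move=> a i; rewrite -mem_enum -(perm_mem a) mem_tnth. Qed.

Lemma cycle_tupleP (n m : nat) (s : 'S_n) (alpha : m.-tuple {set 'I_n})
    (t : 'I_n) :
  perm_eq alpha (enum (porbits s)) -> exists i, t \in tnth alpha i.
Proof.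
move=> a; have : porbit s t \in alpha by rewrite (perm_mem a) mem_enum imset_f.
by case/tnthP=> i defC; exists i; rewrite -defC porbit_id.
Qed.

Lemma cycle_tuple_inj (n m : nat) (s : 'S_n) (alpha : m.-tuple {set 'I_n})
    (i j : 'I_m) (t : 'I_n) :
    perm_eq alpha (enum (porbits s)) ->
  t \in tnth alpha i -> t \in tnth alpha j -> i = j.
Proof.
move=> a; have Ua : uniq alpha by rewrite (perm_uniq a) enum_uniq.
have /imsetP[x _ ex] := mem_cycle_tuple a i.
have /imsetP[y _ ey] := mem_cycle_tuple a j.
rewrite ex ey -!eq_porbit_mem => /eqP etx /eqP ety.
have eij : tnth alpha i = tnth alpha j by rewrite ex ey -etx -ety.
apply: val_inj; apply/eqP; rewrite /= -(nth_uniq set0 _ _ Ua) ?size_tuple //.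
by move: eij; rewrite !(tnth_nth set0) => ->.
Qed.

(** Both numbers have the same multiples: a power of [cube_perm s] fixes [x] exactly when it fixes
    every restriction, because the cycles cover all positions. *)
Lemma card_porbit_cube (n m : nat) (s : 'S_n) (alpha : m.-tuple {set 'I_n})
    (x : cube n) :
    perm_eq alpha (enum (porbits s)) ->
  #|porbit (cube_perm s) x|
    = \big[lcmn/1%N]_(i < m) #|porbit (cube_perm s) (restr (tnth alpha i) x)|.
Proof.
move=> a.
have dvdP N : (#|porbit (cube_perm s) x| %| N)%N =
    (\big[lcmn/1%N]_(i < m) #|porbit (cube_perm s) (restr (tnth alpha i) x)|
      %| N)%N.
  rewrite -permX_fix; apply/eqP/dvdn_biglcmP=> [fx i _|fx].
    by rewrite -permX_fix restr_permX ?(mem_cycle_tuple a) // fx.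
  apply/ffunP=> t; have [i ti] := cycle_tupleP t a.
  have := fx i isT; rewrite -permX_fix restr_permX ?(mem_cycle_tuple a) //.
  by move/eqP/ffunP/(_ t); rewrite !ffunE ti.
by apply/eqP; rewrite eqn_dvd dvdP dvdnn -dvdP dvdnn.
Qed.

Definition cycle_periods (n m N : nat) (s : 'S_n) (alpha : m.-tuple {set 'I_n})
    (z : {ffun 'I_m -> 'I_N}) : {set cube n} :=
  [set x | [forall i,
    #|porbit (cube_perm s) (restr (tnth alpha i) x)| == z i]].

(** The cycles partition the positions, so a point amounts to a free choice of one word per
    cycle. *)
Lemma card_cycle_periods (n m N : nat) (s : 'S_n) (alpha : m.-tuple {set 'I_n})
    (z : {ffun 'I_m -> 'I_N}) :
    perm_eq alpha (enum (porbits s)) ->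
  #|cycle_periods s alpha z|
    = (\prod_(i < m)
        #|[set w in words (tnth alpha i) | #|porbit (cube_perm s) w| == z i]|)%N.
Proof.
move=> a; pose phi x : {ffun 'I_m -> cube n} := [ffun i => restr (tnth alpha i) x].
have phi_inj : injective phi.
  move=> x y /ffunP exy; apply/ffunP=> t; have [i ti] := cycle_tupleP t a.
  by have /ffunP/(_ t) := exy i; rewrite !ffunE ti.
pose F i : pred (cube n) :=
  mem [set w in words (tnth alpha i) | #|porbit (cube_perm s) w| == z i].
rewrite -(card_imset _ phi_inj).
transitivity #|family F|; last first.
  by rewrite card_family foldrE big_map big_enum.
apply: eq_card => f; apply/imsetP/familyP.
- case=> x; rewrite inE => /forallP zx -> i; rewrite ffunE !inE zx andbT.
  by apply/forallP=> t; apply/implyP; rewrite ffunE => /andP[].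
(* Gluing: the supports lie in disjoint cycles, so at each position at most one [f i] is true. *)
- move=> fF; pose x : cube n := [ffun t => [exists i, f i t]].
  have fE i : f i = restr (tnth alpha i) x.
    have := fF i; rewrite !inE => /andP[/forallP fi _]; apply/ffunP=> t.
    rewrite !ffunE; apply/idP/andP=> [fit|[ti /existsP[j fjt]]].
      by split; [exact: (implyP (fi t)) | apply/existsP; exists i].
    have := fF j; rewrite !inE => /andP[/forallP/(_ t)/implyP/(_ fjt) tj _].
    by rewrite (cycle_tuple_inj a ti tj).
  exists x; last by apply/ffunP=> i; rewrite ffunE fE.
  rewrite inE; apply/forallP=> i; rewrite -fE.
  by have := fF i; rewrite !inE => /andP[].
Qed.

Lemma card_cycle_periods_e (n m N : nat) (s : 'S_n)
    (alpha : m.-tuple {set 'I_n}) (z : {ffun 'I_m -> 'I_N}) :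
    perm_eq alpha (enum (porbits s)) ->
    (forall i, z i %| #|tnth alpha i|)%N ->
  #|cycle_periods s alpha z|%:R = \prod_(i < m) ((z i)%:R * e (z i)) :> rat.
Proof.
move=> a zk; rewrite card_cycle_periods // natr_prod; apply: eq_bigr => i _.
exact: card_words_period (mem_cycle_tuple a i) (zk i).
Qed.

Lemma cycle_periods_lcm (n m N : nat) (s : 'S_n)
    (alpha : m.-tuple {set 'I_n}) (z : {ffun 'I_m -> 'I_N}) (x : cube n) :
    perm_eq alpha (enum (porbits s)) -> x \in cycle_periods s alpha z ->
  #|porbit (cube_perm s) x| = lcm_tuple z.
Proof.
move=> a; rewrite inE => /forallP zx; rewrite (card_porbit_cube _ a).
by apply: eq_bigr => i _; apply/eqP.
Qed.

(** Exhibits the rational exponent as a number of orbits, so that truncating it loses nothing. *)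
Lemma expo_cycle_periods (n m N : nat) (s : 'S_n)
    (alpha : m.-tuple {set 'I_n}) (z : {ffun 'I_m -> 'I_N}) :
    perm_eq alpha (enum (porbits s)) ->
    (forall i, z i %| #|tnth alpha i|)%N ->
  expo z = #|porbit (cube_perm s) @: cycle_periods s alpha z|%:R.
Proof.
move=> a zk; have l0 : (0 < lcm_tuple z)%N.
  rewrite /lcm_tuple; elim/big_rec: _ => // i l _ l0; rewrite lcmn_gt0 l0 andbT.
  apply: dvdn_gt0 (zk i); case/imsetP: (mem_cycle_tuple a i) => t _ ->.
  by rewrite lt0n card_porbit_neq0.
rewrite /expo -(card_cycle_periods_e a zk).
rewrite (@card_orbits_uniform _ (cube_perm s) _ (lcm_tuple z)).
- by rewrite natrM mulfK // pnatr_eq0 -lt0n.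
- move=> x; rewrite !inE => /forallP zx; apply/forallP=> i.
  rewrite -[cube_perm s]expg1 -restr_permX ?(mem_cycle_tuple a) //.
  by rewrite expg1 (porbit_perm _ 1).
- by move=> x; apply: cycle_periods_lcm.
Qed.

(** The power [#|C|] of [s] is the identity on [C]. *)
Lemma card_porbit_restr_dvd (n : nat) (s : 'S_n) (C : {set 'I_n}) (x : cube n) :
  C \in porbits s -> (#|porbit (cube_perm s) (restr C x)| %| #|C|)%N.
Proof.
move=> Cs; rewrite -permX_fix restr_permX //; apply/eqP/ffunP=> t.
rewrite !ffunE cube_permX; have [tC|//] := boolP (t \in C).
congr (_ && x _); apply/eqP; rewrite permX_fix.
have -> // : C = porbit s t.
case/imsetP: Cs tC => y _ ->; rewrite -eq_porbit_mem => /eqP->; exact.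
Qed.

(** * Powers of a variable and the cycle index *)

Lemma fpowD (a u v : nat) : fpow a (u + v) = mmul (fpow a u) (fpow a v).
Proof.
have powE w : fpow a w = iter w (mmul (ucm a)) mone.
  by rewrite /fpow /expcmn -Monoid.iteropE.
by rewrite !powE iterD; elim: u => [|u IH] /=; rewrite ?mul1m // IH mulmA.
Qed.

Lemma fpow_sum (I : finType) (P : pred I) (F : I -> nat) (a : nat) :
  fpow a (\sum_(i | P i) F i)%N = \big[mmul/mone]_(i | P i) fpow a (F i).
Proof. by apply: (big_morph (fpow a)) => // u v; exact: fpowD. Qed.

Theorem theorem2 (n m : nat) (sigma : 'S_n) (alpha : m.-tuple {set 'I_n})
    (n_ge1 : (1 <= n)%N)
    (alphaP : perm_eq alpha (enum (porbits sigma))) :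
  let k (i : 'I_m) : nat := #|tnth alpha i| in
  (* the multi-indices (z_1, ..., z_m) with z_i | k_i; note z_i <= k_i <= n *)
  let divs (z : {ffun 'I_m -> 'I_n.+1}) : bool := [forall i, (z i %| k i)%N] in
  [/\ (* the e(k) are integers and the exponents are natural numbers *)
      forall l : nat, (1 <= l)%N -> e l \is a Num.int,
      forall z : {ffun 'I_m -> 'I_n.+1}, divs z -> expo z \is a Num.nat,
      cycle_index_monomial (cube_perm sigma)
        = \mprod_(z | divs z) fpow (lcm_tuple z) (Num.truncn (expo z))
    & forall j : nat, (1 <= j)%N ->
        (ncycles (cube_perm sigma) j)%:R
          = \sum_(z : {ffun 'I_m -> 'I_n.+1} | divs z && (lcm_tuple z == j))
              (\prod_(i < m) ((z i)%:R * e (z i))) / j%:R :> rat].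
Proof.
move=> k divs; set S := cube_perm sigma.
have alphaS := mem_cycle_tuple alphaP.
have expo_nat z : divs z -> expo z \is a Num.nat.
  by move/forallP=> zk; rewrite (expo_cycle_periods alphaP zk) natr_nat.
(* The vector of periods of [x]; [inord] is harmless since each period divides [k i], which is at
   most [n]. The fibres of [p] are the sets [cycle_periods]. *)
pose p x : {ffun 'I_m -> 'I_n.+1} :=
  [ffun i => inord #|porbit S (restr (tnth alpha i) x)|].
have p_val x i : p x i = #|porbit S (restr (tnth alpha i) x)| :> nat.
  have C0 : (0 < k i)%N.
    by case/imsetP: (alphaS i) => t _ e; rewrite /k e lt0n card_porbit_neq0.
  rewrite ffunE inordK // ltnS.
  apply: ssrnat.leq_trans (dvdn_leq C0 (card_porbit_restr_dvd x (alphaS i))) _.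
  by rewrite -[X in (_ <= X)%N]card_ord max_card.
have p_divs x : divs (p x).
  by apply/forallP=> i; rewrite p_val; apply: card_porbit_restr_dvd.
have p_lcm x : lcm_tuple (p x) = #|porbit S x|.
  by rewrite (card_porbit_cube x alphaP); apply: eq_bigr => i _; rewrite p_val.
have p_periods z : cycle_periods sigma alpha z = [set x | p x == z].
  apply/setP=> x; rewrite !inE; apply/forallP/eqP=> [zx|<- i].
    by apply/ffunP=> i; apply: val_inj; rewrite /= p_val; apply/eqP.
  by rewrite p_val.
have ncyclesE j : (1 <= j)%N -> (ncycles S j)%:R
    = \sum_(z : {ffun 'I_m -> 'I_n.+1} | divs z && (lcm_tuple z == j))
        (\prod_(i < m) ((z i)%:R * e (z i))) / j%:R :> rat.
  move=> j1; have j0 : j%:R != 0 :> rat by rewrite pnatr_eq0 -lt0n.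
  (* Multiplying by [j] replaces cycles by the points on them, which are then sorted by [p]. *)
  apply: (mulIf j0); rewrite -mulr_suml mulfVK // -natrM -card_ncycles.
  rewrite -sum1_card (@partition_big _ _ _ _ _ _ _ p
    (fun z => divs z && (lcm_tuple z == j))) /=; last first.
    by move=> x; rewrite inE p_divs p_lcm.
  rewrite natr_sum; apply: eq_bigr => z /andP[/forallP zk /eqP zj].
  rewrite -(card_cycle_periods_e alphaP zk) p_periods sum1dep_card.
  congr (_%:R); apply: eq_card => x; rewrite !inE.
  by have [px|] := eqVneq (p x) z; rewrite ?andbF // -p_lcm px zj eqxx.
split=> //; first by move=> l l1; apply: intr_nat; apply: e_nat.
pose N := #|{: cube n}|.
have ncycles_trunc j : (1 <= j)%N -> ncycles S j
    = (\sum_(z | divs z && (lcm_tuple z == j)) Num.truncn (expo z))%N.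
  move=> j1; apply: (@mulrIn rat 1); rewrite ?oner_eq0 // ncyclesE //.
  rewrite sum_truncnK; last by move=> z /andP[/expo_nat].
  by apply: eq_bigr => z /andP[_ /eqP <-].
rewrite /cycle_index_monomial -/N.
(* Once the two products are exchanged, each [z] meets at most one index [j], namely its lcm. *)
transitivity (\big[mmul/mone]_(1 <= j < N.+1)
    \big[mmul/mone]_(z | divs z && (lcm_tuple z == j))
       fpow (lcm_tuple z) (Num.truncn (expo z))).
  apply: eq_big_nat => j /andP[j1 _]; rewrite ncycles_trunc // fpow_sum.
  by apply: eq_bigr => z /andP[_ /eqP->].
rewrite (exchange_big_dep divs) /=; last by move=> j z _ /andP[].
apply: eq_bigr => z zk.
have [l_in|l_out] := boolP (lcm_tuple z \in index_iota 1 N.+1).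
  under eq_bigl => j do rewrite zk eq_sym.
  by rewrite -big_filter filter_pred1_uniq ?iota_uniq // big_seq1.
(* The lcm may exceed the size of the cube a priori; the exponent is then 0. *)
rewrite big1_seq; last first.
  by move=> j /andP[/andP[_ /eqP<-]]; rewrite (negPf l_out).
suff -> : expo z = 0 by rewrite truncn0.
rewrite (expo_cycle_periods alphaP (forallP zk)) (_ : cycle_periods _ _ _ = set0).
  by rewrite imset0 cards0.
(* A point with periods [z] would have an orbit whose length is the lcm, forcing it into the
   range. *)
apply/setP=> x; rewrite [RHS]inE; apply: contraNF l_out => zx.
rewrite -(cycle_periods_lcm alphaP zx) mem_index_iota ltnS max_card andbT.
by rewrite lt0n card_porbit_neq0.
Qed.
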